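(* For $i\ge 2$ let $\tilde m_i$ be the number of fixed-point-free mappings $f:[i]\to[i]$ that have exactly one component. Then for all $i \ge 2$, $$\tilde m_i = (i-1)!\sum_{j=2}^{i}\frac{i^{i-j}}{(i-j)!} = (i-1)!\,e^{i}\,\mathbb{P}(\mathrm{Po}(i)<i-1).$$ Moreover, for every integer $n\ge 2$, every real $x>0$, and all nonnegative integers $a_2,\dots,a_n$, $$\mathbb{P}(\tilde C_j(n)=a_j,\ j=2,\dots,n)=\mathbf{1}\Big\{\sum_{j=2}^n j a_j=n\Big\}\,\frac{x^{-n}\,n!}{(n-1)^n}\prod_{j=2}^n\left(\frac{\tilde m_j x^j}{j!}\right)^{a_j}\frac{1}{a_j!}.$$
   Context: Write $[n]=\{1,\dots,n\}$. For $n\ge 2$, the screaming toes mapping of size $n$ is the random mapping $f:[n]\to[n]$, $f(i)=B_i$, where $B_1,\dots,B_n$ are independent and $\mathbb{P}(B_i=j)=1/(n-1)$ for $j\in[n]\setminus\{i\}$; equivalently, $f$ is uniform over the $(n-1)^n$ mappings with no fixed points. Two elements $i,j$ are in the same component of a mapping if some iterate of $i$ equals some iterate of $j$ (iterates $f^k$, $k\ge 0$); the size of a component is its number of elements. $\tilde C_j(n)$ is the number of components of size $j$ of the screaming toes mapping of size $n$. $\mathrm{Po}(\mu)$ denotes a Poisson random variable with mean $\mu$. *)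

(* Defs.v *)
From HB Require Import structures.
From mathcomp Require Import all_boot all_order all_algebra.
From mathcomp Require Import all_classical all_reals all_analysis.

Set Implicit Arguments.
Unset Strict Implicit.
Unset Printing Implicit Defensive.

Import Order.TTheory GRing.Theory Num.Theory.

(* Mappings of [n] are rendered as self-maps of 'I_n = {0, ..., n-1}. *)

Section Mappings.
Variables (T : finType) (f : T -> T).

Definition fixpoint_free : bool := [forall i, f i != i].

(* [fconnect f i k] says that k is an iterate of i; see [same_componentP]. *)
Definition same_component : rel T :=
  [rel i j | [exists k, fconnect f i k && fconnect f j k]].

Definition components : {set {set T}} :=
  equivalence_partition same_component [set: T].

Definition num_components (j : nat) : nat :=
  #|[set C in components | #|C| == j]|.

Lemma same_componentP (i j : T) :
  reflect (exists k l : nat, iter k f i = iter l f j) (same_component i j).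
Proof.
apply: (iffP existsP) => [[z /andP[iz jz]]|[k [l e]]].
  by exists (findex f i z), (findex f j z); rewrite !iter_findex.
by exists (iter k f i); rewrite fconnect_iter e fconnect_iter.
Qed.

(* So the blocks of [equivalence_partition] are the equivalence classes. *)
Lemma same_component_equiv : equivalence_rel same_component.
Proof.
apply/equivalence_relP; split=> [i|i j /same_componentP[k [l e]] h].
  by apply/same_componentP; exists 0, 0.
apply/same_componentP/same_componentP => [][p [q e']].
  exists (p + l)%N, (q + k)%N.
  by rewrite iterD -e -iterD addnC iterD e' -iterD addnC.
exists (p + k)%N, (q + l)%N.
by rewrite iterD e -iterD addnC iterD e' -iterD addnC.
Qed.

End Mappings.

Definition num_connected (i : nat) : nat :=
  #|[set f : {ffun 'I_i -> 'I_i} | fixpoint_free f & #|components f| == 1]|.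

Local Open Scope classical_set_scope.
Local Open Scope ring_scope.

Section Probability.
Context {R : realType} {d : measure_display} {T : measurableType d}
  (P : probability T R).

(* Random variables with values in a finite set S, which carries its discrete
   sigma-algebra: every subset of S is measurable. *)
Definition finite_RV {S : finType} (X : T -> S) : Prop :=
  forall A : set S, measurable (X @^-1` A).

Definition mutually_independent {S I : finType} (X : I -> T -> S) : Prop :=
  forall (J : {set I}) (A : I -> set S),
    P (\bigcap_(i in [set` J]) (X i @^-1` A i)) =
      (\prod_(i in J) P (X i @^-1` A i))%E.

Definition screaming_toes {n : nat} (B : 'I_n -> T -> 'I_n) : Prop :=
  [/\ forall i, finite_RV (B i),
      mutually_independent B &
      forall i j : 'I_n, j != i ->
        P (B i @^-1` [set j]) = (((n.-1)%:R : R)^-1)%:E].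

Definition random_mapping {n : nat} (B : 'I_n -> T -> 'I_n) (t : T) :
    {ffun 'I_n -> 'I_n} :=
  [ffun i => B i t].

End Probability.

(* The second argument of the library's [poisson_prob] is unused. *)
Definition Po {R : realType} (mu : R) : probability nat R := poisson_prob mu 0.

(* Main.v *)
Require Import Defs.
From mathcomp Require Import all_boot all_order all_algebra.
From mathcomp Require Import all_classical all_reals all_analysis.
From mathcomp Require Import ring zify.

Import Order.TTheory GRing.Theory Num.Theory.

(* Removing the component C of a chosen element x of S turns a fixed-point-free
   map of S into a connected map of C and a fixed-point-free map of S minus C.
   Counting all maps this way gives, with m_j the number of connected maps,
     (n-1)^n = sum_j C(n-1,j-1) m_j (n-j-1)^(n-j),
   which determines the m_j; that the closed formula solves this recurrence is
   Cauchy's form of Abel's identity, itself a consequence of the fact that the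
   p-th finite difference of t^p is p!.  Counting by component sizes instead,
   the exponential formula satisfies the corresponding recurrence because
   sum_j j a_j = n.  Finally the random mapping is uniform over the
   fixed-point-free maps. *)

Set Implicit Arguments.
Unset Strict Implicit.

(** * Components of a functional graph and the removal of one of them *)

Section FunctionalGraphs.
Variable T : finType.
Implicit Types (f g h : {ffun T -> T}) (A C S : {set T}).

Definition component f x : {set T} := [set y | same_component f x y].

Definition restrict A f : {ffun T -> T} :=
  [ffun i => if i \in A then f i else i].

(* A map of a subset S is encoded by its extension to T by the identity; the
   points outside S then form components of size 1, which no fixed-point-free
   map of S has. *)
Definition fpf_on S : {set {ffun T -> T}} :=
  [set f : {ffun T -> T} | [forall i, f i \in (if i \in S then S :\ i else [set i])]].

Definition connected_on C : {set {ffun T -> T}} :=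
  [set f in fpf_on C | [forall x in C, component f x == C]].

Lemma component_refl f x : x \in component f x.
Proof. by rewrite inE; apply/same_componentP; exists 0, 0. Qed.

Lemma mem_component f x y :
  reflect (exists k l : nat, iter k f x = iter l f y) (y \in component f x).
Proof. by rewrite inE; apply: same_componentP. Qed.

Lemma component_eq f x y : y \in component f x -> component f y = component f x.
Proof.
rewrite inE => xy; have [_ /(_ x y)e] := (equivalence_relP _).1 (@same_component_equiv T f).
by apply/setP => z; rewrite !inE (e xy).
Qed.

Lemma component_stable f x i : (f i \in component f x) = (i \in component f x).
Proof.
apply/mem_component/mem_component => -[k [l e]].
  by exists k, l.+1; rewrite iterSr.
by exists k.+1, l; rewrite iterS e -iterS iterSr.
Qed.

Lemma iter_stable f A k x :
  (forall i, (f i \in A) = (i \in A)) -> (iter k f x \in A) = (x \in A).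
Proof. by move=> fA; elim: k => //= k <-; rewrite fA. Qed.

Lemma component_sub f A x :
  (forall i, (f i \in A) = (i \in A)) -> x \in A -> component f x \subset A.
Proof.
move=> fA xA; apply/fintype.subsetP => y /mem_component[k [l e]].
by rewrite -(iter_stable l y fA) -e iter_stable.
Qed.

(** Iterates that start in [A] stay in [A], and a point with an iterate in [A] lies in [A]; so the
    component of a point of [A] depends only on the values of the map on [A]. *)
Lemma component_local f g A x :
    (forall i, (f i \in A) = (i \in A)) -> (forall i, (g i \in A) = (i \in A)) ->
    {in A, f =1 g} -> x \in A -> component f x = component g x.
Proof.
move=> fA gA fg xA.
have it k y : y \in A -> iter k f y = iter k g y.
  by move=> yA; elim: k => //= k <-; rewrite fg // iter_stable.
have sf := fintype.subsetP (component_sub fA xA).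
have sg := fintype.subsetP (component_sub gA xA).
apply/setP => y; apply/idP/idP => yC; have yA : y \in A by [apply: sf|apply: sg].
  by move: yC => /mem_component[k [l e]]; apply/mem_component; exists k, l; rewrite -!it.
by move: yC => /mem_component[k [l e]]; apply/mem_component; exists k, l; rewrite !it.
Qed.

Lemma componentsE f : components f = [set component f x | x : T].
Proof.
apply/setP => C; apply/imsetP/imsetP => -[x _ ->]; exists x => //;
  by apply/setP => y; rewrite !inE.
Qed.

Lemma restrict_stable f A B : (forall i, (f i \in A) = (i \in A)) ->
  forall i, (restrict B f i \in A) = (i \in A).
Proof. by move=> fA i; rewrite ffunE; case: ifP. Qed.

Lemma component_restrict f A x : (forall i, (f i \in A) = (i \in A)) -> x \in A ->
  component (restrict A f) x = component f x.
Proof.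
move=> fA; apply: component_local => // [i|i iA]; first exact: restrict_stable.
by rewrite ffunE iA.
Qed.

(** The restricted map fixes [x], and sends no point of [A] to [x] because [f] keeps [A] inside
    itself; hence [[set x]] is closed under images and preimages. *)
Lemma component_restrict_out f A x :
  (forall i, (f i \in A) = (i \in A)) -> x \notin A -> component (restrict A f) x = [set x].
Proof.
move=> fA xA; apply/setP => y; rewrite finset.inE; apply/idP/eqP => [|->];
  last exact: component_refl.
have st : forall i, (restrict A f i \in [set x]) = (i \in [set x]).
  move=> i; rewrite ffunE !finset.inE; case: ifPn => // iA.
  by apply/eqP/eqP => e; move: xA; rewrite -e ?fA iA.
by move=> /(fintype.subsetP (component_sub st (set11 x))); rewrite finset.inE => /eqP.
Qed.

(** The other components are unchanged, while the points of the removed one become singletons;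
    [2 <= j] keeps these out of the count. *)
Lemma num_components_restrict f x j : 2 <= j ->
  num_components f j =
    (#|component f x| == j) + num_components (restrict (~: component f x) f) j.
Proof.
set C := component f x => j2.
have fC i : (f i \in ~: C) = (i \in ~: C) by rewrite !finset.in_setC component_stable.
set h := restrict _ f.
have hout i : i \in C -> component h i = [set i].
  by move=> iC; rewrite component_restrict_out // finset.in_setC iC.
have hin i : i \notin C -> component h i = component f i.
  by move=> iC; rewrite component_restrict // finset.in_setC.
rewrite /num_components !componentsE.
set X := [set D in _ | _]; set Y := [set D in [set component h _ | _ : _] | _].
have -> : X = [set D in [set C] | #|D| == j] :|: Y.
  apply/setP => D; rewrite !finset.inE; case: eqP => [Dj|_]; rewrite ?andbF // !andbT.
  apply/imsetP/orP => [[i _ De]|[/eqP ->|/imsetP[i _ De]]].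
  - have [iC|iC] := boolP (i \in C); first by left; rewrite De (component_eq iC).
    by right; apply/imsetP; exists i => //; rewrite hin.
  - by exists x.
  - exists i => //; have [iC|iC] := boolP (i \in C); last by rewrite De hin.
    by move: Dj j2; rewrite De hout // cards1 => <-.
rewrite cardsU disjoint_setI0 ?cards0 ?subn0.
  congr addn; have [Cj|Cj] := eqVneq #|C| j.
    rewrite (_ : [set _ in _ | _] = [set C]) ?cards1 //.
    by apply/setP => D; rewrite !finset.inE; case: eqP => //= ->; apply/eqP.
  rewrite (_ : [set _ in _ | _] = finset.set0) ?cards0 //.
  by apply/setP => D; rewrite !finset.inE; case: eqP => //= ->; apply/negbTE.
rewrite disjoint_subset; apply/fintype.subsetP => D; rewrite !finset.inE => /andP[/eqP-> /eqP Cj].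
rewrite negb_and; apply/orP; left; apply/imsetP => -[i _ Ce].
have [iC|iC] := boolP (i \in C).
  by move: Cj j2; rewrite Ce hout // cards1 => <-.
by move: (component_refl f i); rewrite -(hin _ iC) -Ce (negbTE iC).
Qed.

(** * Counting the fixed-point-free maps of a subset *)

Lemma fpf_onP f S :
  reflect (forall i, if i \in S then f i \in S /\ f i != i else f i = i)
          (f \in fpf_on S).
Proof.
rewrite finset.inE; apply: (iffP forallP) => fS i; have := fS i; case: ifP => // _;
  rewrite !finset.inE; [by case/andP|by move/eqP|by case=> -> ->|by move->].
Qed.

Arguments fpf_onP {f S}.

Lemma fpf_on_stable f S i : f \in fpf_on S -> (f i \in S) = (i \in S).
Proof. by move=> /fpf_onP/(_ i); case: ifP => [_ [->]|iS ->]. Qed.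

Lemma fpf_on_component_sub f S x : f \in fpf_on S -> x \in S -> component f x \subset S.
Proof. by move=> fS; apply: component_sub => i; apply: fpf_on_stable. Qed.

(** The images are chosen independently: [#|S|.-1] choices at each point of [S], one choice outside.
    For empty [S] this is 0^0 = 1, the identity map. *)
Lemma card_fpf_on S : #|fpf_on S| = (#|S|.-1 ^ #|S|)%N.
Proof.
pose F i : {set T} := if i \in S then S :\ i else [set i].
have -> : #|fpf_on S| = #|(family F : simpl_pred {ffun T -> T})|.
  by apply: eq_card => f; rewrite finset.inE; apply/forallP/familyP => h i; have := h i.
rewrite card_family foldrE big_map big_enum /= (bigID (mem S)) /= [X in _ * X]big1 ?muln1.
  rewrite (eq_bigr (fun=> #|S|.-1)) ?prod_nat_const // => i iS.
  by rewrite /F iS (cardsD1 i S) iS.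
by move=> i /negbTE iS; rewrite /F iS cards1.
Qed.

Lemma connected_on_small C : #|C| = 1%N -> connected_on C = finset.set0.
Proof.
move=> /eqP/cards1P[y ->]; apply/setP => f; rewrite !finset.inE; apply/negbTE.
rewrite negb_and -implybE; apply/implyP => /forallP/(_ y).
by rewrite set11 finset.setDv finset.inE.
Qed.

(** Restricting to [C] and to its complement is a bijection onto pairs, with gluing as inverse. The
    predicate [p] lets one bijection serve both the count of all maps and the count by component
    sizes. *)
Lemma card_fpf_on_component (p : pred {ffun T -> T}) S C x : x \in C -> C \subset S ->
  #|[set f in fpf_on S | (component f x == C) && p (restrict (~: C) f)]| =
    (#|connected_on C| * #|[set h in fpf_on (S :\: C) | p h]|)%N.
Proof.
move=> xC CS; rewrite -cardsX.
pose split f := (restrict C f, restrict (~: C) f).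
rewrite -(@card_in_imset _ _ split) => [|f g _ _ [/ffunP e1 /ffunP e2]]; last first.
  apply/ffunP => i; have := e1 i; have := e2 i; rewrite !ffunE finset.in_setC.
  by case: (i \in C).
congr #|pred_of_set _|; apply/setP => -[g h]; rewrite finset.in_setX.
apply/imsetP/andP => [[f]|[]].
  rewrite finset.inE => /and3P[/fpf_onP fS /eqP fC pf] [-> ->].
  have fCi i : (f i \in C) = (i \in C) by rewrite -fC component_stable.
  have fCc i : (f i \in ~: C) = (i \in ~: C) by rewrite !finset.in_setC fCi.
  split; rewrite finset.inE; last first.
    rewrite pf andbT; apply/fpf_onP => i; rewrite ffunE !finset.inE; case iC: (i \in C) => //=.
    by have := fS i; case: ifP => // iS [fiS ni]; rewrite fCi iC.
  apply/andP; split; last first.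
    apply/forall_inP => y yC; rewrite component_restrict //; apply/eqP; rewrite -fC.
    by apply: component_eq; rewrite fC.
  apply/fpf_onP => i; rewrite ffunE; case: (boolP (i \in C)) => // iC.
  by rewrite fCi; have := fS i; rewrite (fintype.subsetP CS) // => -[].
rewrite finset.inE => /andP[gC /forall_inP gcon]; rewrite finset.inE => /andP[hS ph].
(* The glued map: neither [g] nor [h] crosses the boundary of [C], so [C] is stable, and it is the
   component of [x] because [g] is connected on it. *)
pose f := [ffun i => if i \in C then g i else h i] : {ffun T -> T}.
have hC i : i \notin C -> h i \notin C.
  move=> iC; have := fpf_onP hS i; rewrite !finset.inE iC /=.
  by case: ifP => [_ [/andP[]] //|_ -> //].
have fC i : (f i \in C) = (i \in C).
  rewrite ffunE; case: ifPn => iC; first by rewrite (fpf_on_stable _ gC).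
  exact/negbTE/hC.
have fh : restrict (~: C) f = h.
  apply/ffunP => i; rewrite !ffunE !finset.inE; case: (boolP (i \in C)) => //= iC.
  by have := fpf_onP hS i; rewrite !finset.inE iC.
have fg : restrict C f = g.
  apply/ffunP => i; rewrite !ffunE; case: (boolP (i \in C)) => //= iC.
  by have := fpf_onP gC i; rewrite (negbTE iC).
exists f; last by rewrite /split fh fg.
rewrite finset.inE fh ph andbT -(component_restrict fC xC) fg gcon // andbT.
apply/fpf_onP => i; rewrite ffunE; have [iC|iC] := boolP (i \in C).
  rewrite (fintype.subsetP CS) //; have := fpf_onP gC i; rewrite iC => -[giC ->].
  by rewrite (fintype.subsetP CS).
by have := fpf_onP hS i; rewrite !finset.inE iC /=; case: ifP => // iS [/andP[]].
Qed.

Lemma card_by_component (q : pred {ffun T -> T}) S x : x \in S ->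
  #|[set f in fpf_on S | q f]| =
    (\sum_(C : {set T} | (x \in C) && (C \subset S))
       #|[set f in fpf_on S | (component f x == C) && q f]|)%N.
Proof.
move=> xS; rewrite -sum1_card.
rewrite (partition_big (fun f => component f x) (fun C => (x \in C) && (C \subset S))) /=.
  by apply: eq_bigr => C _; rewrite -sum1_card; apply: eq_bigl => f;
    rewrite !finset.inE andbAC andbA.
by move=> f; rewrite finset.inE => /andP[fS _]; rewrite component_refl fpf_on_component_sub.
Qed.

(** Deleting [x] turns [C] into an arbitrary subset of [S :\ x], whence the binomial coefficient
    with both arguments lowered by one. *)
Lemma sum_subsets_containing (R : nmodType) (F : nat -> R) S x : x \in S ->
  (\sum_(C : {set T} | (x \in C) && (C \subset S)) F #|C| =
   \sum_(1 <= j < #|S|.+1) F j *+ 'C(#|S|.-1, j.-1))%R.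
Proof.
move=> xS; have Sx : #|S| = #|S :\ x|.+1 by rewrite (cardsD1 x) xS.
rewrite (reindex_onto (fun D => x |: D) (fun C => C :\ x)) /=; last first.
  by move=> C /andP[xC _]; rewrite finset.setD1K.
rewrite (eq_bigl (fun D : {set T} => D \subset S :\ x)); last first.
  move=> D; apply/andP/idP => [[/andP[_ sub] /eqP <-]|sub]; first exact: finset.setSD.
  have /finset.setU1K -> : x \notin D.
    by apply/negP => /(fintype.subsetP sub); rewrite !finset.inE eqxx.
  rewrite finset.setU11 finset.subUset finset.sub1set xS eqxx; split=> //=.
  exact: fintype.subset_trans sub (subD1set _ _).
rewrite big_add1 /= big_mkord.
rewrite (partition_big (fun D : {set T} => inord #|D| : 'I_#|S :\ x|.+1) xpredT) //= Sx.
apply: eq_bigr => j _ /=; rewrite -cards_draws -sumr_const big_mkcond [RHS]big_mkcond /=.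
apply: eq_bigr => D _; rewrite finset.inE; case: ifPn.
  move=> /andP[sub /eqP e]; have Dj : #|D| = j.
    by rewrite -e inordK // ltnS subset_leq_card.
  have -> : #|x |: D| = j.+1; last by rewrite sub Dj eqxx.
  rewrite cardsU1 Dj (_ : x \notin D) //.
  by apply/negP => /(fintype.subsetP sub); rewrite !finset.inE eqxx.
move=> ne; case: ifP => // /andP[sub /eqP e]; case/negP: ne.
by rewrite sub e; apply/eqP/val_inj; rewrite /= inordK.
Qed.

End FunctionalGraphs.

Arguments fpf_onP {T f S}.

(** * Finite differences, Abel's identity and the recurrence for connected maps *)

Section Abel.
Local Open Scope ring_scope.
Variable R : numFieldType.
Implicit Types (x y s : R).

(** The [p]-th forward difference, with step one, of t^q at t = [x]. *)
Definition finite_difference (p q : nat) x : R :=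
  \sum_(k < p.+1) (-1) ^+ (p - k) * (x + k%:R) ^+ q *+ 'C(p, k).

(** Split one factor x + k of the power; the part with k is absorbed by k C(p+1,k) = (p+1) C(p,k-1),
    which shifts [x] to [x + 1]. *)
Lemma finite_difference_recr p q x :
  finite_difference p.+1 q.+1 x =
    x * finite_difference p.+1 q x + p.+1%:R * finite_difference p q (x + 1).
Proof.
rewrite /finite_difference !mulr_sumr big_ord_recl [in RHS]big_ord_recl -addrA -big_split /=.
congr (_ + _); first by rewrite exprS addr0 !bin0 !mulr1n mulrCA.
apply: eq_bigr => i _; rewrite /bump /= !add1n subSS exprS.
rewrite -(natr1 i) -addrA [1 + i%:R]addrC !addrA.
set u := _ ^+ (p - i); set v := _ ^+ q.
have e : 'C(p.+1, i.+1)%:R * (i%:R + 1) = p.+1%:R * 'C(p, i)%:R :> R.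
  by rewrite natr1 -!natrM mulnC mul_bin_diag.
rewrite -!(mulr_natr (_ * _)) mulrA.
transitivity (u * v * (x * 'C(p.+1, i.+1)%:R) +
    u * v * ('C(p.+1, i.+1)%:R * (i%:R + 1))); first by ring.
by rewrite e; ring.
Qed.

Lemma finite_difference0 p x : finite_difference p 0 x = (p == 0%N)%:R.
Proof.
transitivity ((-1 + 1 : R) ^+ p); last by rewrite addNr expr0n.
by rewrite exprDn; apply: eq_bigr => i _; rewrite !expr0 expr1n.
Qed.

Lemma finite_difference_small p q x : (q < p)%N -> finite_difference p q x = 0.
Proof.
elim: q p x => [|q IH] [|p] x // qp; first by rewrite finite_difference0.
by rewrite finite_difference_recr IH 1?ltnW // IH // !mulr0 addr0.
Qed.

Lemma finite_difference_fact p x : finite_difference p p x = p`!%:R.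
Proof.
elim: p x => [|p IH] x; first by rewrite finite_difference0.
by rewrite finite_difference_recr finite_difference_small // IH mulr0 add0r -natrM.
Qed.

Lemma sum_ord_widen (F : nat -> R) n N : (n <= N)%N ->
  (forall m, (n <= m)%N -> F m = 0) -> \sum_(m < n) F m = \sum_(m < N) F m.
Proof.
move=> nN F0; rewrite (big_ord_widen _ F nN) big_mkcond; apply: eq_bigr => m _.
by case: ltnP => // /F0 ->.
Qed.

(* Expanding each power of y + N - k = s - (x + k), where s = x + y + N, turns
   the inner sums into finite differences. *)
Lemma abel_cauchy N x y :
  \sum_(k < N.+1) (x + k%:R) ^+ k * (y + (N - k)%:R) ^+ (N - k) *+ 'C(N, k) =
    \sum_(m < N.+1) (x + y + N%:R) ^+ m * (N - m)`!%:R *+ 'C(N, m).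
Proof.
set s := x + y + N%:R.
(* The expanded summand, its binomials regrouped so that for fixed [m] the sum over [k] is a
   difference of order [N - m] of a power of the same degree. It vanishes for k + m > N, so both
   indices may run up to [N]. *)
pose F (k m : nat) : R :=
  (-1) ^+ (N - m - k) * (x + k%:R) ^+ (N - m) * s ^+ m *+ ('C(N, m) * 'C(N - m, k)).
have binC k m : (k + m <= N)%N -> ('C(N, m) * 'C(N - m, k) = 'C(N - k, m) * 'C(N, k))%N.
  move=> kmN; apply/eqP; rewrite -(@eqn_pmul2r (m`! * k`! * (N - m - k)`!)) ?muln_gt0 ?fact_gt0 //.
  have mN : (m <= N)%N by apply: leq_trans kmN; apply: leq_addl.
  have kN : (k <= N)%N by apply: leq_trans kmN; apply: leq_addr.
  have e1 := bin_fact mN; have e2 := bin_fact kN.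
  have /bin_fact e3 : (k <= N - m)%N by rewrite leq_subRL // addnC.
  have /bin_fact e4 : (m <= N - k)%N by rewrite leq_subRL.
  move: e4; rewrite subnAC => e4.
  apply/eqP; transitivity N`!; first by rewrite -[RHS]e1 -e3; ring.
  by rewrite -[LHS]e2 -e4; ring.
transitivity (\sum_(k < N.+1) \sum_(m < N.+1) F k m).
  apply: eq_bigr => k _; have kN : (k <= N)%N by rewrite -ltnS.
  have -> : y + (N - k)%:R = - (x + k%:R) + s by rewrite /s natrB //; ring.
  rewrite [X in _ * X *+ _]exprDn mulr_sumr -sumrMnl.
  rewrite -(@sum_ord_widen (F k) (N - k).+1) ?ltnS ?leq_subr // => [|m km]; last first.
    rewrite /F; have [mN|mN] := leqP m N; last by rewrite bin_small ?mul0n ?mulr0n.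
    by rewrite [X in (_ * X)%N]bin_small ?muln0 ?mulr0n // ltn_subLR // addnC -ltn_subLR.
  apply: eq_bigr => m _; have mN : (m <= N - k)%N by rewrite -ltnS.
  have kmN : (k + m <= N)%N by rewrite -leq_subRL.
  rewrite /F binC // mulrnA mulrnAr; congr (_ *+ _ *+ _).
  have e1 : (N - m = k + (N - k - m))%N.
    by rewrite subnAC subnKC // leq_subRL 1?addnC // (leq_trans _ kmN) // leq_addl.
  by rewrite [in LHS]exprNn e1 addKn exprD; ring.
rewrite exchange_big; apply: eq_bigr => m _; rewrite -(finite_difference_fact (N - m) x).
rewrite /finite_difference mulr_sumr -sumrMnl.
rewrite -(@sum_ord_widen (F^~ m) (N - m).+1) ?ltnS ?leq_subr // => [|k km].
  apply: eq_bigr => k _; rewrite /F mulrnAr -mulrnA mulnC; congr (_ *+ _); ring.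
by rewrite /F [X in (_ * X)%N]bin_small ?muln0 ?mulr0n.
Qed.

(** The closed formula of the theorem, kept as a definition until it is shown to count connected
    maps. At j = 1 the sum is empty and the value is 0. *)
Definition connected_count (j : nat) : R :=
  (j.-1)`!%:R * \sum_(2 <= l < j.+1) j%:R ^+ (j - l) / ((j - l)`!)%:R.

Lemma fact_neq0 n : n`!%:R != 0 :> R.
Proof. by rewrite pnatr_eq0 -lt0n fact_gt0. Qed.

Lemma binR n m : (m <= n)%N -> 'C(n, m)%:R = n`!%:R / (m`!%:R * (n - m)`!%:R) :> R.
Proof.
move=> mn; rewrite -(bin_fact mn) !natrM; field.
by rewrite !fact_neq0.
Qed.

(** The term u^m / m! occurs r + 1 - m times on the left, and m u^m / m! = u u^(m-1) / (m-1)! gives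
    the subtracted part. For u = r + 1 the right side collapses to a single term. *)
Lemma sum_exp_partial (u : R) (E := fun q : nat => \sum_(m < q) u ^+ m / m`!%:R) r :
  \sum_(q < r.+1) E q.+1 = r.+1%:R * E r.+1 - u * E r.
Proof.
have ES q : E q.+1 = E q + u ^+ q / q`!%:R by rewrite /E big_ord_recr.
elim: r => [|r IH].
  by rewrite big_ord_recr big_ord0 /= ES /E big_ord0; ring.
rewrite big_ord_recr /= IH (ES r.+1) (ES r) factS natrM exprS.
rewrite -[r.+2%:R]natr1; field.
by rewrite fact_neq0 addrC natr1 pnatr_eq0.
Qed.

(** After interchanging the sums, the sum over [j] for fixed [l] is Abel's identity with x = l, y =
    -1, N = n - l. Then x + y + N = n - 1 is independent of [l], and partial exponential sums at n -
    1 remain, to be added by [sum_exp_partial]. *)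
Lemma connected_count_abel n : (0 < n)%N ->
  (n.-1)%:R ^+ n =
    \sum_(1 <= j < n.+1)
      connected_count j * ((n - j).-1)%:R ^+ (n - j) *+ 'C(n.-1, j.-1).
Proof.
move=> n0.
pose G (j l : nat) : R := (n.-1)`!%:R / (n - l)`!%:R *
  (j%:R ^+ (j - l) * ((n - j).-1)%:R ^+ (n - j) *+ 'C(n - l, j - l)).
transitivity (\sum_(1 <= j < n.+1) \sum_(2 <= l < n.+1) if (l < j.+1)%N then G j l else 0);
    last first.
  apply: eq_big_nat => j /andP[j1 jn].
  rewrite -big_mkcond -(big_nat_widen _ _ _ xpredT (G j)) //.
  rewrite /connected_count mulr_sumr mulr_suml -sumrMnl; apply: eq_big_nat => l /andP[l2 lj].
  have [lj' jn'] : (l <= j)%N /\ (j <= n)%N by [].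
  have ljn : (j.-1 <= n.-1)%N by rewrite -ltnS !prednK.
  rewrite /G -(mulr_natr _ 'C(n - l, j - l)) -(mulr_natr _ 'C(n.-1, j.-1)).
  rewrite (binR ljn) (binR (leq_sub2r l jn')).
  have -> : (n - l - (j - l) = n - j)%N by rewrite subnBA // subnK // (leq_trans lj').
  have -> : (n.-1 - j.-1 = n - j)%N by case: (n) n0 j1 => // ? _; case: (j).
  by field; rewrite !fact_neq0.
rewrite exchange_big_nat /=.
have inner l : (2 <= l < n.+1)%N -> \sum_(1 <= j < n.+1) (if (l < j.+1)%N then G j l else 0) =
    (n.-1)`!%:R * \sum_(m < (n - l).+1) (n.-1)%:R ^+ m / m`!%:R.
  move=> /andP[l2 ln]; rewrite -big_mkcond.
  rewrite -(big_nat_widenl _ _ _ xpredT (fun j => G j l)) ?(ltnW l2) //.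
  rewrite -{1}[l]add0n big_addn subSn // big_mkord -mulr_sumr.
  have -> : \sum_(k < (n - l).+1) (k + l)%:R ^+ (k + l - l) *
        ((n - (k + l)).-1)%:R ^+ (n - (k + l)) *+ 'C(n - l, k + l - l) =
      \sum_(k < (n - l).+1) (l%:R + k%:R) ^+ k * (-1 + (n - l - k)%:R) ^+ (n - l - k)
        *+ 'C(n - l, k) :> R.
    apply: eq_bigr => k _; rewrite addnK addnC natrD subnDA.
    (* For j = n the truncated predecessor is 0 instead of -1, but the exponent is then 0 too. *)
    case: (n - l - k)%N => [|m]; first by rewrite !expr0.
    by have -> : -1 + m.+1%:R = m%:R :> R by rewrite -natr1; ring.
  have -> := abel_cauchy (n - l) l%:R (-1).
  have -> : l%:R + -1 + (n - l)%:R = (n.-1)%:R :> R.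
    by rewrite natrB // -subn1 natrB //; ring.
  rewrite !mulr_sumr; apply: eq_bigr => m _; have mn : (m <= n - l)%N by rewrite -ltnS.
  rewrite -(mulr_natr _ 'C(_, m)) (binR mn); field.
  by rewrite !fact_neq0.
rewrite (eq_big_nat _ _ inner) -mulr_sumr big_nat_rev /= -{1}[2%N]add0n big_addn big_mkord.
(* For n = 1 both sides are 0. Otherwise n = p + 2, and the reversed index q = n - l runs over
   partial sums with 1 to p + 1 terms. *)
case: n n0 {G inner} => [|[|p]] // _; first by rewrite big_ord0 mulr0 expr0n.
rewrite (eq_bigr (fun q : 'I_p.+1 => \sum_(m < q.+1) p.+1%:R ^+ m / m`!%:R)); last first.
  move=> q _; have -> // : (p.+2 - (2 + p.+3 - (q + 2).+1) = q)%N.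
  by have := ltn_ord q; lia.
rewrite (sum_exp_partial p.+1%:R) -mulrBr big_ord_recr /= addrAC subrr add0r.
rewrite factS natrM !exprS; field.
exact: fact_neq0.
Qed.
End Abel.

(** * The exponential formula for component types and its recurrence *)

Section TypeWeights.
Variables (R : numFieldType) (n : nat).
Implicit Types (a : nat -> nat) (w : nat -> R).
Local Open Scope ring_scope.

(** A type [a] prescribes [a j] components of each size [j]; this is the number of points they
    occupy. *)
Definition weight a : nat := (\sum_(2 <= j < n.+1) j * a j)%N.

(** The type left after removing one component of size [j]. Subtraction truncates at [a j = 0],
    hence the conditions [0 < a j] below. *)
Definition decr a j : nat -> nat := fun k => (a k - (k == j))%N.

Lemma weight_decr a j : (2 <= j <= n)%N -> (0 < a j)%N ->
  weight a = (weight (decr a j) + j)%N.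
Proof.
move=> jn aj; have ji : j \in index_iota 2 n.+1 by rewrite mem_index_iota.
rewrite /weight !(bigD1_seq j ji (iota_uniq _ _)) /= /decr eqxx.
rewrite (eq_bigr (fun k => k * (a k - (k == j)))%N) => [|k /negbTE ->]; last by rewrite subn0.
by case: (a j) aj => // m _; rewrite subn1 /= mulnS -addnA addnC.
Qed.

(** Only the factor at [j] changes, by w w^(b-1) / (b-1)! = b w^b / b!. *)
Lemma prod_decr w a j : (2 <= j <= n)%N -> (0 < a j)%N ->
  w j * \prod_(2 <= k < n.+1) (w k ^+ decr a j k * (decr a j k)`!%:R^-1) =
    (a j)%:R * \prod_(2 <= k < n.+1) (w k ^+ a k * (a k)`!%:R^-1).
Proof.
move=> jn aj; have ji : j \in index_iota 2 n.+1 by rewrite mem_index_iota.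
rewrite !(bigD1_seq j ji (iota_uniq _ _)) /= {1 2}/decr eqxx.
rewrite (eq_bigr (fun k => w k ^+ a k * (a k)`!%:R^-1)) => [|k /negbTE jk]; last first.
  by rewrite /decr jk subn0.
case: (a j) aj => // m _; rewrite subn1 /= factS natrM exprS; field.
by rewrite fact_neq0 addrC natr1 pnatr_eq0.
Qed.

(** A single component larger than [s] would already exceed the weight, so larger sizes contribute
    nothing. *)
Lemma weight_le_cut a s : (s <= n)%N -> weight a = s ->
  (\sum_(2 <= j < s.+1) j * a j)%N = s.
Proof.
move=> sn as_; rewrite -{2}as_ /weight (big_nat_widen _ _ _ _ _ (_ : s.+1 <= n.+1)%N) //.
rewrite big_mkcond; apply: eq_big_nat => j /andP[j2 jn]; case: ltnP => //= sj.
suff /eqP -> : a j == 0%N by rewrite muln0.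
rewrite -leqn0 leqNgt; apply/negP => aj.
suff : (j <= s)%N by rewrite leqNgt sj.
by rewrite -as_ (@weight_decr a j) ?leq_addl // j2 -ltnS.
Qed.

Lemma weight_eq0 a : (weight a == 0)%N = [forall j : 'I_n.+1, (2 <= j)%N ==> (0 == a j)%N].
Proof.
apply/eqP/forallP => [a0 j|a0].
  apply/implyP => j2; rewrite eq_sym -leqn0 leqNgt; apply/negP => aj.
  by have := @weight_decr a j; rewrite a0 j2 -ltnS ltn_ord => /(_ isT aj); lia.
rewrite /weight big1_seq // => j; rewrite mem_index_iota => /andP[_ /andP[j2 jn]].
by have := a0 (Ordinal jn); rewrite j2 /= => /eqP <-; rewrite muln0.
Qed.

(** The exponential formula at x = 1 for maps of [s] points. *)
Definition type_count a (s : nat) : R :=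
  (weight a == s)%:R * s`!%:R *
    \prod_(2 <= j < n.+1) ((connected_count R j / j`!%:R) ^+ a j * (a j)`!%:R^-1).

Lemma connected_count1 : connected_count R 1 = 0.
Proof. by rewrite /connected_count big_geq // mulr0. Qed.

(** Write s! = (s-1)! s and replace the factor s by the sum of the j a_j; the share j a_j is the
    term for removing a component of size [j]. *)
Lemma type_count_recurrence a s : (0 < s <= n)%N ->
  type_count a s =
    \sum_(1 <= j < s.+1)
      connected_count R j * (0 < a j)%N%:R * type_count (decr a j) (s - j)%N
        *+ 'C(s.-1, j.-1).
Proof.
move=> /andP[s0 sn]; set w := fun j => connected_count R j / j`!%:R.
rewrite big_ltn ?ltnS // connected_count1 !mul0r mul0rn add0r.
pose Q := \prod_(2 <= j < n.+1) (w j ^+ a j * (a j)`!%:R^-1).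
transitivity ((weight a == s)%:R * ((s.-1)`!%:R * Q) * (\sum_(2 <= j < s.+1) j * a j)%N%:R).
  rewrite /type_count; case: eqP => [as_|_]; last by rewrite !mul0r.
  rewrite weight_le_cut // -{1}(prednK s0) factS prednK // natrM -/Q; ring.
rewrite natr_sum mulr_sumr; apply: eq_big_nat => j /andP[j2 js].
have jn : (2 <= j <= n)%N by rewrite j2 (leq_trans _ sn).
have [->|aj] := posnP (a j); first by rewrite muln0 !mulr0 !mul0r mul0rn.
have -> : (weight a == s) = (weight (decr a j) == s - j)%N.
  by rewrite (weight_decr jn aj) -[in LHS](subnK (_ : j <= s)%N) // eqn_add2r.
rewrite /type_count -(mulr_natr _ 'C(_, _)).
have js' : (j.-1 <= s.-1)%N by rewrite -ltnS !prednK // ltnW.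
rewrite (binR _ js'); have -> : (s.-1 - j.-1 = s - j)%N by lia.
have -> : (s.-1)`!%:R * Q = (s.-1)`!%:R * (w j / (a j)%:R *
    \prod_(2 <= k < n.+1) (w k ^+ decr a j k * (decr a j k)`!%:R^-1)).
  by rewrite mulrAC prod_decr // mulrAC mulfV ?mul1r // pnatr_eq0 -lt0n.
have jfact : j`!%:R = j%:R * (j.-1)`!%:R :> R by rewrite -natrM; case: (j) j2.
rewrite natrM; set P := \prod_(_ <= _ < _) _.
rewrite {1}/w jfact (mulr1 (connected_count R j)); field.
by rewrite !fact_neq0 !pnatr_eq0 -!lt0n aj (ltnW j2).
Qed.
End TypeWeights.

(** * Counting connected maps and maps of a given type by induction on the set *)

Section Counting.
Variables (T : finType) (R : numFieldType).
Implicit Types (f g h : {ffun T -> T}) (C S : {set T}).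

(** The true count and the formula satisfy the same recurrence. In the difference of the two, proper
    subsets cancel by induction, and the term for the whole set has cofactor 0^0 = 1, so it vanishes
    as well. *)
Lemma card_connected_on C : 0 < #|C| ->
  (#|connected_on C|%:R = connected_count R #|C|)%R.
Proof.
have [m] := ubnP #|C|; elim: m C => // m IH S /ltnSE Sm S0.
have /card_gt0P[x xS] := S0.
pose err C : R := ((#|connected_on C|%:R - connected_count R #|C|) * #|fpf_on (S :\: C)|%:R)%R.
have : (\sum_(C : {set T} | (x \in C) && (C \subset S)) err C = 0)%R.
  have e1 : (#|fpf_on S|%:R = \sum_(C : {set T} | (x \in C) && (C \subset S))
      (#|connected_on C|%:R * #|fpf_on (S :\: C)|%:R) :> R)%R.
    have all D : #|[set f in fpf_on D | predT f]| = #|fpf_on D|.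
      by apply: eq_card => f; rewrite finset.inE andbT.
    rewrite -all (card_by_component predT xS) natr_sum; apply: eq_bigr => C /andP[xC CS].
    by rewrite (card_fpf_on_component predT xC CS) natrM all.
  have e2 : (#|fpf_on S|%:R = \sum_(C : {set T} | (x \in C) && (C \subset S))
      (connected_count R #|C| * #|fpf_on (S :\: C)|%:R) :> R)%R.
    rewrite card_fpf_on natrX connected_count_abel //.
    rewrite -(sum_subsets_containing (fun j =>
      (connected_count R j * ((#|S| - j).-1)%:R ^+ (#|S| - j))%R) xS).
    apply: eq_bigr => C /andP[_ CS].
    by rewrite card_fpf_on natrX cardsD (finset.setIidPr CS).
  by rewrite /err; under eq_bigr do rewrite mulrBl; rewrite sumrB -e1 -e2 subrr.
rewrite (bigD1 S) ?xS //= big1 => [|C /andP[/andP[xC CS] nC]].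
  rewrite addr0 /err finset.setDv card_fpf_on cards0 expn0 mulr1.
  by move/eqP; rewrite subr_eq0 => /eqP.
rewrite /err IH ?subrr ?mul0r //; last by apply/card_gt0P; exists x.
by apply: leq_trans Sm; apply: proper_card; rewrite finset.properEneq nC.
Qed.

(** Sizes below 2 are ignored because the encoding creates singletons outside the subset. *)
Definition has_type n (a : nat -> nat) f :=
  [forall j : 'I_n.+1, (2 <= j) ==> (num_components f j == a j)].

(** The component of [x] is itself one of size [#|C|], so [a #|C|] is positive; conversely
    positivity must be required, since [decr] truncates. *)
Lemma has_type_restrict n a f x (C := component f x) : 2 <= #|C| <= n ->
  has_type n a f = (0 < a #|C|) && has_type n (decr a #|C|) (restrict (~: C) f).
Proof.
move=> /andP[C2 Cn]; apply/forallP/andP => [fa|[aC /forallP ha] j].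
  have fC : num_components f #|C| = a #|C|.
    by have := fa (Ordinal (Cn : #|C| < n.+1)); rewrite /= C2 => /eqP.
  split; first by rewrite -fC (num_components_restrict f x) // eqxx.
  apply/forallP => j; apply/implyP => j2; have := fa j; rewrite j2 /decr => /eqP <-.
  by rewrite (num_components_restrict f x) // [(j == _ :> nat)]eq_sym addKn.
apply/implyP => j2; have := ha j; rewrite j2 (num_components_restrict f x) // => /eqP ->.
by rewrite /decr [(j == _ :> nat)]eq_sym; apply/eqP/subnKC; case: eqP => // <-.
Qed.

Lemma num_components_fpf_on0 f j : f \in fpf_on finset.set0 -> 2 <= j -> num_components f j = 0.
Proof.
move=> f0 j2; apply/eqP; rewrite cards_eq0; apply/eqP/setP => D; rewrite finset.inE [RHS]finset.inE.
apply/negbTE; rewrite negb_and -implybE; apply/implyP; rewrite componentsE => /imsetP[i _ ->].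
have fi k : f k = k by have := fpf_onP f0 k; rewrite finset.inE.
suff : component f i \subset [set i].
  by move=> /subset_leq_card; rewrite cards1 => i1; apply/eqP => ij;
    move: i1 j2; rewrite ij; case: (j) => [|[]].
by apply: component_sub; rewrite ?set11 // => k; rewrite fi.
Qed.

(** Induction on [#|S|]: splitting by the component of a chosen point matches
    [type_count_recurrence] term by term. On the empty set the identity realises exactly the types
    of weight 0. *)
Lemma card_fpf_on_type n a S : #|S| <= n ->
  (#|[set f in fpf_on S | has_type n a f]|%:R = type_count R n a #|S|)%R.
Proof.
have [m] := ubnP #|S|; elim: m a S => // m IH a S /ltnSE Sm Sn.
have [S0|/card_gt0P[x xS]] := posnP #|S|.
  move: S0 => /eqP; rewrite cards_eq0 => /eqP ->.
  rewrite /type_count cards0 fact0 mulr1.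
  have -> : [set f in fpf_on finset.set0 | has_type n a f] =
      if weight n a == 0 then fpf_on finset.set0 else finset.set0 :> {set {ffun T -> T}}.
    rewrite weight_eq0; apply/setP => f; rewrite finset.inE.
    rewrite (_ : (_ && _) = (f \in fpf_on finset.set0) &&
      [forall j : 'I_n.+1, (2 <= j) ==> (0 == a j)]).
      by case: ifP => _; rewrite ?andbT // andbF finset.inE.
    case f0: (f \in _) => //=; apply: eq_forallb => j.
    by case: leqP => //= j2; rewrite num_components_fpf_on0.
  case: eqP => [w0|_]; last by rewrite cards0 mul0r.
  rewrite card_fpf_on cards0 expn0 mul1r big1_seq // => j.
  rewrite mem_index_iota => /andP[_ /andP[j2 jn]].
  move: w0 => /eqP; rewrite weight_eq0 => /forallP/(_ (Ordinal jn)); rewrite /= j2 => /eqP <-.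
  by rewrite expr0 fact0 invr1 mulr1.
have S0 : 0 < #|S| by apply/card_gt0P; exists x.
rewrite type_count_recurrence ?S0 // (card_by_component _ xS) natr_sum.
rewrite -(sum_subsets_containing (fun j =>
  connected_count R j * (0 < a j)%:R * type_count R n (decr a j) (#|S| - j))%R xS).
apply: eq_bigr => C /andP[xC CS].
have C0 : 0 < #|C| by apply/card_gt0P; exists x.
have Cn := leq_trans (subset_leq_card CS) Sn.
(* A singleton carries no connected map and the formula is 0 there, so both terms vanish;
   [has_type_restrict] covers larger sizes. *)
have [C2|C1] := ltnP 1 #|C|; last first.
  have {}C1 : #|C| = 1 by apply/eqP; rewrite eqn_leq C1.
  rewrite C1 connected_count1 !mul0r; apply/eqP; rewrite pnatr_eq0 -leqn0.
  have <- : #|[set f in fpf_on S | (component f x == C) && predT (restrict (~: C) f)]| = 0.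
    by rewrite card_fpf_on_component // connected_on_small // cards0.
  by apply/subset_leq_card/fintype.subsetP => f; rewrite !finset.inE => /and3P[-> -> _].
have -> : [set f in fpf_on S | (component f x == C) && has_type n a f] =
    [set f in fpf_on S | (component f x == C) &&
       ((0 < a #|C|) && has_type n (decr a #|C|) (restrict (~: C) f))].
  apply/setP => f; rewrite [LHS]finset.inE [RHS]finset.inE; congr andb.
  by case: eqP => //= fC; rewrite (@has_type_restrict n a f x) fC // C2.
rewrite (card_fpf_on_component (fun h => (0 < a #|C|) && has_type n (decr a #|C|) h) xC CS).
rewrite natrM card_connected_on // -mulrA; congr (_ * _)%R.
have SC : #|S :\: C| = #|S| - #|C| by rewrite cardsD (finset.setIidPr CS).
rewrite -SC -IH ?SC //; last 2 first.
- by apply: leq_trans Sm; rewrite ltn_subrL C0.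
- exact: leq_trans (leq_subr _ _) Sn.
case: (0 < a _); rewrite ?mul1r // mul0r.
by rewrite (_ : [set _ in _ | _] = finset.set0) ?cards0 //;
  apply/setP => h; rewrite !finset.inE andbF.
Qed.
End Counting.

(** * Closed forms for the number of connected maps, and the Poisson probability *)

Lemma num_connectedE (R : numFieldType) i : 0 < i ->
  ((num_connected i)%:R = connected_count R i)%R.
Proof.
move=> i0; rewrite -[in RHS](card_ord i) -[in RHS]cardsT -card_connected_on ?cardsT ?card_ord //.
(* On the full set no point is left to be fixed by the encoding. Having one component means that
   every component is everything; [i0] supplies a point for the converse. *)
congr (_%:R)%R; apply: eq_card => f; rewrite [LHS]finset.inE [RHS]finset.inE; congr andb.
  apply/forallP/fpf_onP => h k; first by rewrite finset.inE; split=> //; apply: h.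
  by have := h k; rewrite finset.inE => -[].
rewrite componentsE; apply/cards1P/forall_inP => [[D De] x _|h].
  have Dc y : component f y = D.
    by apply/set1P; rewrite -De; apply/imsetP; exists y.
  by apply/eqP/setP => y; rewrite finset.in_setT Dc -(Dc y) component_refl.
exists [set: 'I_i]; apply/setP => D; rewrite finset.in_set1; apply/imsetP/eqP => [[x _ ->]|->].
  exact/eqP/h.
by exists (Ordinal i0) => //; apply/esym/eqP/h.
Qed.

Local Open Scope classical_set_scope.
Local Open Scope ring_scope.

(** Substituting k = i - j exhibits a partial sum of the exponential series at i, as in the Poisson
    law. *)
Lemma connected_count_expE (R : numFieldType) i : (2 <= i)%N ->
  connected_count R i = (i.-1)`!%:R * \sum_(k < i.-1) i%:R ^+ k / k`!%:R.
Proof.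
move=> i2; rewrite /connected_count big_nat_rev /= -{1}[2%N]add0n big_addn big_mkord.
have -> : (i.+1 - 2 = i.-1)%N by lia.
congr (_ * _); apply: eq_bigr => q _.
by have -> : (i - (2 + i.+1 - (q + 2).+1) = q)%N by have := ltn_ord q; lia.
Qed.

Lemma Po_lt (R : realType) (mu : R) m : 0 < mu ->
  Po mu [set k : nat | (k < m)%N] = (expR (- mu) * \sum_(k < m) mu ^+ k / k`!%:R)%:E.
Proof.
move=> mu0; rewrite /Po /= /poisson_prob mu0 esum_fset; last 2 first.
- exact: finite_II.
- by move=> k _; rewrite lee_fin poisson_pmf_ge0.
rewrite -fsbig_ord sumEFin mulr_sumr; congr EFin; apply: eq_bigr => k _.
by rewrite /poisson_pmf mu0 mulrC.
Qed.

(** * The distribution of the random mapping *)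

Section RandomMappings.
Context {R : realType} {d : measure_display} {T : measurableType d}
  (P : probability T R).

Lemma probability_preimage_set (S : finType) (X : T -> S) (A : {set S}) :
  (forall s, measurable (X @^-1` [set s])) ->
  (P (X @^-1` [set` A]) = \sum_(s in A) P (X @^-1` [set s]))%E.
Proof.
move=> mX; rewrite -big_enum /=.
have -> : [set` A] = [set` enum A] by apply/seteqP; split => s /=; rewrite mem_enum.
have consE s l : X @^-1` [set` s :: l] = X @^-1` [set s] `|` X @^-1` [set` l].
  by apply/seteqP; split => t /=; rewrite in_cons => /predU1P.
have mXl (l : seq S) : measurable (X @^-1` [set` l]).
  elim: l => [|s l IH]; last by rewrite consE; apply: measurableU.
  by rewrite (_ : _ @^-1` _ = set0); last by apply/seteqP; split.
have : uniq (enum A) by apply: enum_uniq.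
elim: (enum A) => [|s l IH] /=.
  by rewrite big_nil (_ : _ @^-1` _ = set0) ?measure0 //; apply/seteqP; split.
move=> /andP[sl ul]; rewrite consE measureU ?big_cons ?IH //.
  by congr (_ + _)%E; apply: IH.
 by apply/seteqP; split => t //= -[->] sl'; move: sl; rewrite sl'.
Qed.

Variables (n : nat) (B : 'I_n -> T -> 'I_n).
Hypotheses (n2 : (2 <= n)%N) (toes : screaming_toes P B).

(** The n - 1 off-diagonal values have probability 1/(n-1) each and exhaust the total mass 1. *)
Lemma screaming_toes_fixpoint i : (P (B i @^-1` [set i]) = 0)%E.
Proof.
case: toes => mB _ unif.
have : (\sum_(j in [set: 'I_n]%SET) P (B i @^-1` [set j]) = 1)%E.
  rewrite -probability_preimage_set; last by move=> s; apply: mB.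
  rewrite -(probability_setT P); congr (P _); apply/seteqP; split => t //= _.
  by rewrite finset.inE.
rewrite (bigD1 i) ?finset.inE //= (eq_bigr (fun=> (((n.-1)%:R : R)^-1)%:E)); last first.
  by move=> j /andP[_ ji]; rewrite unif.
rewrite sumEFin (eq_bigl (mem [set~ i]%SET)) => [|j]; last by rewrite !finset.inE.
rewrite sumr_const cardsC1 card_ord -(mulr_natr (n.-1)%:R^-1) mulVf ?pnatr_eq0;
  last by case: (n) n2 => [|[]].
have : P (B i @^-1` [set i]) \is a fin_num by apply: fin_num_measure; apply: mB.
by move=> /fineK <-; rewrite -EFinD => -[] e; congr EFin; apply: (addIr 1); rewrite e add0r.
Qed.

Lemma random_mapping_preimage (f : {ffun 'I_n -> 'I_n}) :
  random_mapping B @^-1` [set f] =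
    \bigcap_(i in [set` [set: 'I_n]%SET]) (B i @^-1` [set f i]).
Proof.
apply/seteqP; split => t /=; first by move=> /ffunP h i _ /=; rewrite -h ffunE.
by move=> h; apply/ffunP => i; rewrite ffunE; apply: h => /=; rewrite finset.inE.
Qed.

(** By independence this is a product over the points, in which any fixed point of [f] contributes a
    factor 0. *)
Lemma random_mapping_prob (f : {ffun 'I_n -> 'I_n}) :
  P (random_mapping B @^-1` [set f]) =
    ((f \in fpf_on [set: 'I_n]%SET)%:R * (n.-1)%:R ^- n)%:E.
Proof.
case: toes => mB indep unif; rewrite random_mapping_preimage.
have := indep [set: 'I_n]%SET (fun i => [set f i]) => /= ->.
have [fS|] := boolP (f \in _).
  rewrite (eq_bigr (fun=> (((n.-1)%:R : R)^-1)%:E)); last first.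
    by move=> i _; apply: unif; have := fpf_onP fS i; rewrite finset.inE => -[].
  by rewrite prodEFin prodr_const cardsT card_ord exprVn mul1r.
rewrite finset.inE negb_forall => /existsP[i].
rewrite !finset.inE andbT negbK => /eqP fi.
by rewrite (bigD1 i) ?finset.inE //= fi screaming_toes_fixpoint mul0e mul0r.
Qed.

Lemma random_mapping_measurable (f : {ffun 'I_n -> 'I_n}) :
  measurable (random_mapping B @^-1` [set f]).
Proof.
case: toes => mB _ _; rewrite random_mapping_preimage.
by apply: fin_bigcap_measurable => // i _; apply: mB.
Qed.

Lemma random_mapping_type_prob (a : nat -> nat) :
  P [set t : T | forall j : nat, (2 <= j <= n)%N ->
                   num_components (random_mapping B t) j = a j] =
    (type_count R n a n * (n.-1)%:R ^- n)%:E.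
Proof.
pose A := [set f : {ffun 'I_n -> 'I_n} | has_type n a f]%SET.
rewrite (_ : [set t | _] = random_mapping B @^-1` [set` A]); last first.
  apply/seteqP; split => t /=; rewrite finset.inE => h.
    apply/forallP => j; apply/implyP => j2; apply/eqP/h.
    by rewrite j2 -ltnS ltn_ord.
  move=> j /andP[j2 jn]; have := forallP h (Ordinal (jn : (j < n.+1)%N)).
  by rewrite j2 => /eqP.
rewrite probability_preimage_set; last exact: random_mapping_measurable.
under eq_bigr do rewrite random_mapping_prob.
rewrite sumEFin -mulr_suml; congr (_ * _)%:E.
have := @card_fpf_on_type _ R n a [set: 'I_n]%SET; rewrite cardsT card_ord leqnn => <- //.
rewrite -natr_sum -sum1_card big_mkcond [in RHS]big_mkcond; congr (_%:R); apply: eq_bigr => f _.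
by rewrite [in LHS]finset.inE [in RHS]finset.inE andbC; case: (has_type n a f); case: (f \in _).
Qed.
End RandomMappings.

(** * The free parameter x and the final assembly *)

Lemma type_count_scale (R : numFieldType) n (a : nat -> nat) (x : R) : x != 0 ->
  type_count R n a n =
    (weight n a == n)%:R * (x ^- n * n`!%:R) *
    \prod_(2 <= j < n.+1)
      ((connected_count R j * x ^+ j / j`!%:R) ^+ a j * (a j)`!%:R^-1).
Proof.
move=> x0; rewrite /type_count; case: eqP => [wn|_]; last by rewrite !mul0r.
rewrite [in RHS](eq_bigr (fun j => x ^+ (j * a j) *
    ((connected_count R j / j`!%:R) ^+ a j * (a j)`!%:R^-1))) => [|j _]; last first.
  by rewrite [_ * x ^+ j / _]mulrAC [in LHS]exprMn -exprM [RHS]mulrA [X in _ = X * _]mulrC.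
(* The powers x^(j a_j) multiply to x^n because the weight is n, and this cancels x^(-n). *)
rewrite [in RHS]big_split /= -expr_sum -/(weight n a) wn [RHS]mulrA.
by congr (_ * _); rewrite -[RHS]mulrA [x ^- n * _ * _]mulrAC mulVf ?mul1r // expf_neq0.
Qed.

Unset Implicit Arguments.
Set Strict Implicit.

Theorem mainTheorem1 (R : realType) :
  (forall i : nat, (2 <= i)%N ->
     (num_connected i)%:R =
       (i.-1)`!%:R * \sum_(2 <= j < i.+1) i%:R ^+ (i - j) / ((i - j)`!)%:R :> R
     /\
     ((num_connected i)%:R : R)%:E =
       (((i.-1)`!%:R * expR (i%:R : R))%:E *
         Po (i%:R : R) [set k : nat | (k < i.-1)%N])%E)
  /\
  (forall (n : nat) (x : R) (a : nat -> nat)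
     (d : measure_display) (T : measurableType d) (P : probability T R)
     (B : 'I_n -> T -> 'I_n),
     (2 <= n)%N -> 0 < x -> screaming_toes P B ->
     P [set t : T | forall j : nat, (2 <= j <= n)%N ->
                      num_components (random_mapping B t) j = a j] =
       (((\sum_(2 <= j < n.+1) j * a j)%N == n)%:R *
        (x ^- n * n`!%:R / (n.-1)%:R ^+ n) *
        \prod_(2 <= j < n.+1)
          (((num_connected j)%:R * x ^+ j / j`!%:R) ^+ a j * (a j)`!%:R^-1))%:E).
Proof.
split=> [i i2|n x a d T P B n2 x0 toes].
  have i0 : (0 < i)%N by apply: ltnW.
  rewrite num_connectedE //; split=> //.
  rewrite Po_lt ?ltr0n // -EFinM connected_count_expE //; congr EFin.
  by rewrite -[RHS]mulrA; congr (_ * _); rewrite mulrA expRxMexpNx_1 mul1r.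
rewrite (random_mapping_type_prob n2 toes) (type_count_scale _ _ (lt0r_neq0 x0)).
congr EFin; rewrite mulrAC -[X in X * _ = _]mulrA; congr (_ * _).
by apply: eq_big_nat => j /andP[j2 _]; rewrite num_connectedE // ltnW.
Qed.
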